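(* Let $L$ be a finite-dimensional nilpotent cyclic Leibniz algebra over a field. Then $L$ is upper semi-modular.
   Context: A (right) Leibniz algebra over a field $F$ is an $F$-vector space $L$ with a bilinear product $[\cdot,\cdot]$ satisfying $[x,[y,z]]=[[x,y],z]-[[x,z],y]$ for all $x,y,z\in L$. $L$ is nilpotent if $L^{k}=0$ for some $k$, where $L^1=L$, $L^{k+1}=[L^k,L]$. $L$ is cyclic if it is generated, as a Leibniz algebra, by a single element. For subalgebras $U,B$, $\langle U,B\rangle$ denotes the subalgebra generated by $U\cup B$. A subalgebra $U$ of $L$ is upper semi-modular in $L$ if $U$ is a maximal subalgebra of $\langle U,B\rangle$ for every subalgebra $B$ of $L$ such that $U\cap B$ is maximal in $B$. $L$ is upper semi-modular if every subalgebra of $L$ is upper semi-modular in $L$. *)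

(* Defs.v *)
From mathcomp Require Import all_boot all_order all_algebra.
From mathcomp Require Import boolp.

Set Implicit Arguments.
Unset Strict Implicit.
Unset Printing Implicit Defensive.

Import GRing.Theory.
Local Open Scope ring_scope.

Definition right_leibniz (F : fieldType) (L : vectType F)
    (br : {bilinear L -> L -> L}) : Prop :=
  forall x y z : L, br x (br y z) = br (br x y) z - br (br x z) y.

(* [U, V], the span of all products br u v with u in U and v in V; by
   bilinearity the products of basis vectors suffice, see bracketvP. *)
Definition bracketv (F : fieldType) (L : vectType F)
    (br : {bilinear L -> L -> L}) (U V : {vspace L}) : {vspace L} :=
  <<[seq br u v | u <- vbasis U, v <- vbasis V]>>%VS.

Lemma memv_bracket (F : fieldType) (L : vectType F)
    (br : {bilinear L -> L -> L}) (U V : {vspace L}) (u v : L) :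
  u \in U -> v \in V -> br u v \in bracketv br U V.
Proof.
move=> Uu Vv; rewrite (coord_vbasis Uu) (coord_vbasis Vv).
rewrite linear_sumlz; apply: memv_suml => i _.
rewrite linear_sumr; apply: memv_suml => j _.
rewrite linearZl_LR linearZr_LR /= !memvZ // memv_span //.
by apply: allpairs_f; apply: mem_nth; rewrite size_tuple.
Qed.

Lemma bracketvP (F : fieldType) (L : vectType F)
    (br : {bilinear L -> L -> L}) (U V W : {vspace L}) :
  reflect {in U & V, forall u v, br u v \in W} (bracketv br U V <= W)%VS.
Proof.
apply: (iffP idP) => [sUVW u v Uu Vv | sUVW].
  exact: subvP sUVW _ (memv_bracket br Uu Vv).
apply/span_subvP=> _ /allpairsP[[u v] /= [Uu Vv ->]].
by apply: sUVW; exact: vbasis_mem.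
Qed.

(* Shifted index: lower_central br k is L^{k+1}, where L^1 = L and
   L^{k+1} = [L^k, L]. *)
Definition lower_central (F : fieldType) (L : vectType F)
    (br : {bilinear L -> L -> L}) (k : nat) : {vspace L} :=
  iter k (fun U => bracketv br U fullv) fullv.

Definition nilpotent_leibniz (F : fieldType) (L : vectType F)
    (br : {bilinear L -> L -> L}) : Prop :=
  exists k : nat, lower_central br k = 0%VS.

Definition subalgebra (F : fieldType) (L : vectType F)
    (br : {bilinear L -> L -> L}) (U : {vspace L}) : Prop :=
  {in U &, forall x y, br x y \in U}.

Definition least_subalgebra (F : fieldType) (L : vectType F)
    (br : {bilinear L -> L -> L}) (X : {pred L}) (M : {vspace L}) : Prop :=
  [/\ subalgebra br M, {subset X <= M} &
      forall S : {vspace L},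
        subalgebra br S -> {subset X <= S} -> (M <= S)%VS].

Lemma least_subalgebra_ex (F : fieldType) (L : vectType F)
    (br : {bilinear L -> L -> L}) (X : {pred L}) :
  exists M : {vspace L}, least_subalgebra br X M.
Proof.
suff: forall n (M : {vspace L}), (\dim M <= n)%N -> subalgebra br M ->
    {subset X <= M} -> exists M', least_subalgebra br X M'.
  move=> /(_ _ fullv (leqnn _)); apply; first by move=> *; exact: memvf.
  by move=> *; exact: memvf.
elim=> [|n IHn] M dimM subM sXM.
  exists M; split=> // S _ _.
  by move: dimM; rewrite leqn0 dimv_eq0 => /eqP ->; exact: sub0v.
have [leastM|] := pselect (forall S : {vspace L},
    subalgebra br S -> {subset X <= S} -> (M <= S)%VS); first by exists M.
move=> /existsNP[S /not_implyP[subS /not_implyP[sXS nsMS]]].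
apply: (IHn (M :&: S)%VS).
- rewrite -ltnS; apply: leq_trans dimM; rewrite ltn_neqAle dimvS ?capvSl // andbT.
  apply/negP => eqd; apply: nsMS; apply/capv_idPl/eqP.
  by rewrite eqEdim capvSl (eqP eqd) leqnn.
- move=> x y /memv_capP[Mx Sx] /memv_capP[My Sy].
  by apply/memv_capP; split; [exact: subM | exact: subS].
- by move=> x Xx; apply/memv_capP; split; [exact: sXM | exact: sXS].
Qed.

(* The choice is harmless: a least subalgebra is unique by antisymmetry. *)
Definition generated_subalgebra (F : fieldType) (L : vectType F)
    (br : {bilinear L -> L -> L}) (X : {pred L}) : {vspace L} :=
  sval (cid (least_subalgebra_ex br X)).

Lemma generated_subalgebraP (F : fieldType) (L : vectType F)
    (br : {bilinear L -> L -> L}) (X : {pred L}) :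
  least_subalgebra br X (generated_subalgebra br X).
Proof. exact: svalP (cid (least_subalgebra_ex br X)). Qed.

Definition cyclic_leibniz (F : fieldType) (L : vectType F)
    (br : {bilinear L -> L -> L}) : Prop :=
  exists a : L, generated_subalgebra br (pred1 a) = fullv.

Definition join_subalgebra (F : fieldType) (L : vectType F)
    (br : {bilinear L -> L -> L}) (U B : {vspace L}) : {vspace L} :=
  generated_subalgebra br [predU U & B].

Definition maximal_subalgebra (F : fieldType) (L : vectType F)
    (br : {bilinear L -> L -> L}) (U M : {vspace L}) : Prop :=
  [/\ subalgebra br U, (U <= M)%VS, U <> M &
      forall S : {vspace L}, subalgebra br S ->
        (U <= S)%VS -> (S <= M)%VS -> S = U \/ S = M].

Definition upper_semimodular_in (F : fieldType) (L : vectType F)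
    (br : {bilinear L -> L -> L}) (U : {vspace L}) : Prop :=
  forall B : {vspace L}, subalgebra br B ->
    maximal_subalgebra br (U :&: B)%VS B ->
    maximal_subalgebra br U (join_subalgebra br U B).

Definition upper_semimodular (F : fieldType) (L : vectType F)
    (br : {bilinear L -> L -> L}) : Prop :=
  forall U : {vspace L}, subalgebra br U -> upper_semimodular_in br U.

(* Main.v *)
Require Import Defs.
From mathcomp Require Import all_boot all_order all_algebra.

Set Implicit Arguments.
Unset Strict Implicit.

Import GRing.Theory.
Local Open Scope ring_scope.

(** Write L^2 = [L, L] and let a generate L.  The right annihilator
    K = {y | [L, y] = 0} is an ideal by the Leibniz identity, and it contains
    [a, a] because [x, [a, a]] = [[x, a], a] - [[x, a], a].  Hence <a> + K is a
    subalgebra containing a, so it is L, and therefore L^2 <= K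
    ([bracket_derived_r]): products with right factor in L^2 vanish, and every
    subspace of L^2 is a subalgebra.  For the same reason <a> + L^2 = L, so L^2
    has codimension at most one; a subalgebra U not inside L^2 thus satisfies
    U + L^2 = L, and nilpotency then forces U = L ([supplement_derived_full]).

    Thus the subalgebras of L are L itself and the subspaces of L^2
    ([subalgebra_derivedVfull]).  Upper semi-modularity is immediate when U or B
    is L, and otherwise it is the modular law for subspaces
    ([maximal_join_of_sub_derived]). *)

Section RightAnnihilator.

Variables (F : fieldType) (L : vectType F) (br : {bilinear L -> L -> L}).

(** The right annihilator {y | [L, y] = 0}; a basis of left factors is used so
    that it is a finite intersection of kernels, hence a subspace. *)
Definition rannv : {vspace L} :=
  (\bigcap_(i < \dim {:L}) lker (linfun (br (vbasis {:L})`_i)))%VS.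

Lemma rannvP (y : L) : reflect (forall x, br x y = 0) (y \in rannv).
Proof.
apply: (iffP idP) => [Ky x | Ky].
  rewrite (coord_vbasis (memvf x)) linear_sumlz big1 // => i _.
  move/subv_bigcapP: Ky => /(_ i isT); rewrite -memvE memv_ker lfunE => /eqP.
  by rewrite linearZl_LR => ->; rewrite scaler0.
by apply/subv_bigcapP => i _; rewrite -memvE memv_ker lfunE /= Ky.
Qed.

Lemma bracket_rannv_l (br_leibniz : right_leibniz br) (y z : L) :
  y \in rannv -> br y z \in rannv.
Proof.
move=> /rannvP Ky; apply/rannvP => x.
by rewrite br_leibniz !Ky linear0l subr0.
Qed.

Lemma bracket_diag_rannv (br_leibniz : right_leibniz br) (y : L) :
  br y y \in rannv.
Proof. by apply/rannvP => x; rewrite br_leibniz subrr. Qed.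

Lemma bracket_line_rannv (br_leibniz : right_leibniz br) (a u v : L) :
    u \in (<[a]> + rannv)%VS -> v \in (<[a]> + rannv)%VS ->
  br u v \in rannv.
Proof.
move=> /memv_addP[_ /vlineP[c ->] [y Ky ->]].
move=> /memv_addP[_ /vlineP[d ->] [z /rannvP Kz ->]].
rewrite linearDr /= Kz addr0 linearZr_LR linearDl linearZl_LR /=.
rewrite memvZ // memvD ?memvZ //; first exact: bracket_diag_rannv.
exact: bracket_rannv_l.
Qed.

End RightAnnihilator.

Section CyclicLeibniz.

Variables (F : fieldType) (L : vectType F) (br : {bilinear L -> L -> L}).

Local Notation L2 := (bracketv br fullv fullv).

Lemma generated_eq_fullv (X : {pred L}) (S : {vspace L}) :
    generated_subalgebra br X = fullv -> subalgebra br S ->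
  {subset X <= S} -> S = fullv.
Proof.
have [_ _ leastX] := generated_subalgebraP br X.
move=> genX subS sXS; apply/eqP; rewrite eqEsubv subvf -genX.
exact: leastX.
Qed.

Lemma cyclic_rannv (br_leibniz : right_leibniz br) (a : L) :
  generated_subalgebra br (pred1 a) = fullv -> (<[a]> + rannv br)%VS = fullv.
Proof.
move=> gen_a; apply: generated_eq_fullv gen_a _ _.
  move=> x y aKx aKy; apply: subvP (addvSr _ _) _ _.
  exact: bracket_line_rannv aKx aKy.
move=> _ /[!inE]/eqP->; apply: subvP (addvSl _ _) _ _; exact: memv_line.
Qed.

Lemma bracket_derived_r (br_leibniz : right_leibniz br)
    (br_cyclic : cyclic_leibniz br) (x y : L) :
  y \in L2 -> br x y = 0.
Proof.
have [a /(cyclic_rannv br_leibniz) genK] := br_cyclic.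
suff /subvP sL2K: (L2 <= rannv br)%VS by move=> /sL2K/rannvP.
apply/bracketvP => u v Lu Lv.
by apply: (@bracket_line_rannv _ _ br br_leibniz a); rewrite genK.
Qed.

Lemma sub_derived_subalgebra (br_leibniz : right_leibniz br)
    (br_cyclic : cyclic_leibniz br) (W : {vspace L}) :
  (W <= L2)%VS -> subalgebra br W.
Proof.
by move=> /subvP sW x y _ /sW L2y; rewrite bracket_derived_r ?mem0v.
Qed.

Lemma cyclic_derived (a : L) :
  generated_subalgebra br (pred1 a) = fullv -> (<[a]> + L2)%VS = fullv.
Proof.
move=> gen_a; apply: generated_eq_fullv gen_a _ _.
  move=> x y _ _; apply: subvP (addvSr _ _) _ _.
  by rewrite memv_bracket ?memvf.
move=> _ /[!inE]/eqP->; apply: subvP (addvSl _ _) _ _; exact: memv_line.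
Qed.

(** The Frattini property of nilpotent algebras.  Modulo products that vanish,
    [L^k, L] = [L^k, U], and L^k <= U + L^{k+1} turns this into
    L^{k+1} <= U + L^{k+2}; so L = U + L^k for every k. *)
Lemma supplement_derived_full (br_leibniz : right_leibniz br)
    (br_nilpotent : nilpotent_leibniz br) (br_cyclic : cyclic_leibniz br)
    (U : {vspace L}) :
  subalgebra br U -> (U + L2)%VS = fullv -> U = fullv.
Proof.
move=> subU UL2.
have step k : (lower_central br k <= U + lower_central br k.+1)%VS.
  elim: k => [|k IHk]; first by rewrite /= UL2 subvf.
  apply/bracketvP => x y /(subvP IHk)/memv_addP[u Uu [x' Lx' ->]] _.
  have: y \in (U + L2)%VS by rewrite UL2 memvf.
  move=> /memv_addP[v Uv [z L2z ->]].
  rewrite linearDr /= [br _ z]bracket_derived_r // addr0 linearDl.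
  by rewrite memv_add ?subU //; apply: memv_bracket => //; exact: memvf.
have full k : (U + lower_central br k)%VS = fullv.
  elim: k => [|k IHk]; first exact: addvf.
  apply/eqP; rewrite eqEsubv subvf -[X in (X <= _)%VS]IHk subv_add addvSl.
  exact: step.
by have [k k0] := br_nilpotent; rewrite -(full k) k0 addv0.
Qed.

Lemma subalgebra_derivedVfull (br_leibniz : right_leibniz br)
    (br_nilpotent : nilpotent_leibniz br) (br_cyclic : cyclic_leibniz br)
    (U : {vspace L}) :
  subalgebra br U -> (U <= L2)%VS \/ U = fullv.
Proof.
move=> subU; case: (boolP (U <= L2)%VS) => [|/subvPn[u Uu L2u]]; first by left.
right; apply: supplement_derived_full => //.
have [a /cyclic_derived aL2] := br_cyclic.
apply/eqP; rewrite eqEsubv subvf -[X in (X <= _)%VS]aL2 subv_add addvSr andbT.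
have: u \in (<[a]> + L2)%VS by rewrite aL2 memvf.
move=> /memv_addP[_ /vlineP[c ->] [y L2y def_u]].
have c_neq0 : c != 0.
  by apply: contraNneq L2u => c0; rewrite def_u c0 scale0r add0r.
have -> : a = c^-1 *: u + - (c^-1 *: y).
  by rewrite def_u scalerDr scalerA mulVf // scale1r addrK.
by rewrite -memvE memv_add ?memvN ?memvZ.
Qed.

Lemma join_subalgebra_fullr (U : {vspace L}) :
  join_subalgebra br U fullv = fullv.
Proof.
have [_ sUB _] := generated_subalgebraP br [predU U & {:L}%VS].
apply/eqP; rewrite eqEsubv subvf; apply/subvP => x Lx.
by apply: sUB; rewrite !inE Lx orbT.
Qed.

Lemma join_subalgebra_addv (U B : {vspace L}) :
  subalgebra br (U + B)%VS -> join_subalgebra br U B = (U + B)%VS.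
Proof.
have [_ sUB leastUB] := generated_subalgebraP br [predU U & B].
move=> subUB; apply/eqP; rewrite eqEsubv; apply/andP; split.
  apply: leastUB => // x /orP[Ux | Bx].
    exact: subvP (addvSl _ _) _ Ux.
  exact: subvP (addvSr _ _) _ Bx.
rewrite subv_add; apply/andP; split; apply/subvP => x Sx; apply: sUB.
  by rewrite !inE Sx.
by rewrite !inE Sx orbT.
Qed.

(** By the modular law S = U + (S :&: B) whenever U <= S <= U + B, and
    S :&: B lies between U :&: B and B. *)
Lemma maximal_join_of_sub_derived (br_leibniz : right_leibniz br)
    (br_cyclic : cyclic_leibniz br) (U B : {vspace L}) :
    (U <= L2)%VS -> (B <= L2)%VS -> maximal_subalgebra br (U :&: B)%VS B ->
  maximal_subalgebra br U (join_subalgebra br U B).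
Proof.
move=> UL2 BL2 [_ _ neqUB maxUB].
have sub_L2 := sub_derived_subalgebra br_leibniz br_cyclic.
rewrite join_subalgebra_addv; last by apply: sub_L2; rewrite subv_add UL2.
split=> [||eqU|S _ sUS sSUB]; [exact: sub_L2 | exact: addvSl | |].
  by apply: neqUB; apply/capv_idPr; rewrite eqU addvSr.
have defS : S = (U + (S :&: B))%VS.
  by rewrite capvC vspace_modl //; apply/esym/capv_idPr.
have [||| eqSB | eqSB] := maxUB (S :&: B)%VS.
- by apply: sub_L2; apply: subv_trans (capvSr _ _) BL2.
- exact: capvS.
- exact: capvSr.
- by left; rewrite defS eqSB; apply/addv_idPl; exact: capvSl.
- by right; rewrite defS eqSB.
Qed.

End CyclicLeibniz.

Unset Implicit Arguments.
Set Strict Implicit.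

Theorem lemma4p3 (F : fieldType) (L : vectType F)
    (br : {bilinear L -> L -> L}) (br_leibniz : right_leibniz br)
    (br_nilpotent : nilpotent_leibniz br) (br_cyclic : cyclic_leibniz br) :
  upper_semimodular br.
Proof.
move=> U subU B subB maxUB.
have classify := subalgebra_derivedVfull br_leibniz br_nilpotent br_cyclic.
have [UL2 | U_full] := classify U subU; last first.
  (* U = L is impossible: U :&: B = B is not a proper subalgebra of B. *)
  by have [_ _ []] := maxUB; rewrite U_full; apply/capv_idPr/subvf.
have [BL2 | B_full] := classify B subB; last first.
  by move: maxUB; rewrite B_full join_subalgebra_fullr capvf.
exact: maximal_join_of_sub_derived.
Qed.
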